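(* Let $n,q,m,N,s_0,\dots,s_{n-1}$ be positive integers with $m\le N$, put $s=s_0s_1\cdots s_{n-1}$, and assume $m\mid qs$. Let $\mathbb{F}$ be a finite field with $|\mathbb{F}|\ge N$ containing a primitive $s_k$-th root of unity $\omega_{s_k}$ for each $k\in\{0,\dots,n-1\}$. Consider the distributed problem of computing the $n$-dimensional Fourier transforms $T_0,\dots,T_{q-1}$ of $q$ input tensors $t_0,\dots,t_{q-1}\in\mathbb{F}^{s_0\times\cdots\times s_{n-1}}$ using $N$ workers that can each store and process a $\frac1m$ fraction of the entire input. Then the recovery threshold $K^*=m$ is optimal: the minimum of the recovery thresholds over all computation strategies equals $m$.
   Context: $n$-dimensional discrete Fourier transforms: the input is a tuple $(t_0,\dots,t_{q-1})$ of tensors $t_h=(t_{h,j_0\dots j_{n-1}})$ with entries in $\mathbb{F}$ and indices $j_\ell\in\{0,\dots,s_\ell-1\}$; the output is the tuple $(T_0,\dots,T_{q-1})$ of tensors of the same dimensions defined, for $h\in\{0,\dots,q-1\}$, by $$T_{h,i_0i_1\dots i_{n-1}}=\sum_{\substack{j_\ell\in\{0,\dots,s_\ell-1\}\\ \forall \ell\in\{0,\dots,n-1\}}}t_{h,j_0j_1\dots j_{n-1}}\prod_{k=0}^{n-1}\omega_{s_k}^{i_kj_k}.$$ Computation strategy: a tuple of $N$ encoding functions $f_0,\dots,f_{N-1}$ and $N$ computing functions $g_0,\dots,g_{N-1}$, where $f_i:(\mathbb{F}^{s_0\times\cdots\times s_{n-1}})^q\to\mathbb{F}^{qs/m}$ and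 $g_i:\mathbb{F}^{qs/m}\to\mathbb{F}^{qs/m}$ are arbitrary functions. Worker $i$ stores $a_i=f_i(t_0,\dots,t_{q-1})$, computes $b_i=g_i(a_i)\in\mathbb{F}^{qs/m}$, and returns $b_i$ to the master. Recoverability: for an integer $k\in\{0,\dots,N\}$, a computation strategy is $k$-recoverable if for every set $S\subseteq\{0,\dots,N-1\}$ with $|S|=k$ there is a decoding function $d_S$ such that $d_S\big((b_i)_{i\in S}\big)=(T_0,\dots,T_{q-1})$ for all inputs $(t_0,\dots,t_{q-1})$. The recovery threshold of a computation strategy is the minimum $k$ for which it is $k$-recoverable (a strategy that is not $k$-recoverable for any $k\in\{0,\dots,N\}$ has no recovery threshold and is disregarded in the minimum). *)

(* Defs.v *)
From mathcomp Require Import all_boot all_algebra.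

Set Implicit Arguments.
Unset Strict Implicit.
Unset Printing Implicit Defensive.

Import GRing.Theory.

Definition tindex (n : nat) (s : 'I_n -> nat) :=
  {dffun forall l : 'I_n, 'I_(s l)}.

Definition tensor (F : finFieldType) (n : nat) (s : 'I_n -> nat) :=
  {ffun tindex s -> F}.

Definition tensors (F : finFieldType) (q n : nat) (s : 'I_n -> nat) :=
  {ffun 'I_q -> tensor F s}.

(* [omega d] is the chosen primitive d-th root of unity; only its values at
   the side lengths [s k] are used, and equal side lengths share one root. *)
Definition dft (F : finFieldType) (q n : nat) (s : 'I_n -> nat)
    (omega : nat -> F) (t : tensors F q s) : tensors F q s :=
  [ffun h : 'I_q => [ffun i : tindex s =>
    (\sum_(j : tindex s)
       t h j * \prod_(k < n) omega (s k) ^+ (i k * j k)%N)%R]].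

(* The number of symbols in a 1/m fraction of the input. *)
Definition worker_size (q n : nat) (s : 'I_n -> nat) (m : nat) : nat :=
  (q * \prod_(k < n) s k) %/ m.

Definition worker_data (F : finFieldType) (q n : nat) (s : 'I_n -> nat)
    (m : nat) :=
  'rV[F]_(worker_size q s m).

Record strategy (F : finFieldType) (q n : nat) (s : 'I_n -> nat) (m N : nat) :=
  Strategy {
    encode : 'I_N -> tensors F q s -> worker_data F q s m;
    compute : 'I_N -> worker_data F q s m -> worker_data F q s m
  }.

Definition worker_output (F : finFieldType) (q n : nat) (s : 'I_n -> nat)
    (m N : nat) (st : strategy F q s m N) (i : 'I_N) (t : tensors F q s) :
    worker_data F q s m :=
  compute st i (encode st i t).

Definition recoverable (F : finFieldType) (q n : nat) (s : 'I_n -> nat)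
    (m N : nat) (omega : nat -> F) (st : strategy F q s m N) (k : nat) : Prop :=
  forall S : {set 'I_N}, #|S| = k ->
    exists d : {ffun {i : 'I_N | i \in S} -> worker_data F q s m} ->
               tensors F q s,
      forall t : tensors F q s,
        d [ffun i : {i : 'I_N | i \in S} => worker_output st (val i) t] =
        dft omega t.

Definition is_minimum (P : nat -> Prop) (k : nat) : Prop :=
  P k /\ forall j : nat, P j -> k <= j.

(* A relation rather than a function, since a strategy may have no recovery
   threshold. The bound j <= N matters: [recoverable] is vacuous beyond N. *)
Definition is_recovery_threshold (F : finFieldType) (q n : nat)
    (s : 'I_n -> nat) (m N : nat) (omega : nat -> F)
    (st : strategy F q s m N) (k : nat) : Prop :=
  is_minimum (fun j : nat => j <= N /\ recoverable omega st j) k.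

(* Main.v *)
(* Encoders are arbitrary, so the input can be packed into an m x (qs/m)
   matrix whose rows are encoded by a Reed-Solomon code: worker i receives the
   value at the i-th point of F of the vector polynomial whose coefficients are
   the rows, and any m values determine the polynomial, hence the input.
   Conversely the Fourier transform is injective, so the k outputs from which
   it is decoded, taking at most |F|^(k qs/m) values, must separate |F|^(qs)
   inputs; hence k >= m. *)

Require Import Defs.
From mathcomp Require Import all_boot all_algebra.

Set Implicit Arguments.
Unset Strict Implicit.
Unset Printing Implicit Defensive.

Import GRing.Theory.

(** Serves to factor sums over [tindex s], where the range of each index depends on the dimension.
    The inner sums move to tagged pairs, a single type to which ordinary distributivity applies. *)
Lemma bigA_distr_dffun (R : comNzSemiRingType) (I : finType)
    (J : I -> finType) (G : forall i, J i -> R) :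
  (\prod_i \sum_(j : J i) G i j =
   \sum_(f : {dffun forall i, J i}) \prod_i G i (f i))%R.
Proof.
pose g i := [ffun j : J i => G i j].
transitivity (\prod_i \sum_(j : J i) g i j)%R.
  by apply: eq_bigr => i _; apply: eq_bigr => j _; rewrite ffunE.
under eq_bigr => i _ do rewrite (big_tag (fun i => g i)).
rewrite bigA_distr_big_dep -(big_fprod _ _ g).
rewrite (reindex (@fprod_of_dffun I J)) /=; last first.
  exact/onW_bij/fprod_of_dffun_bij.
by apply: eq_bigr => f _; apply: eq_bigr => i _; rewrite fprodE ffunE.
Qed.

Lemma card_tindex (n : nat) (s : 'I_n -> nat) :
  #|{: tindex s}| = \prod_(k < n) s k.
Proof.
rewrite -(bij_eq_card (dffun_of_fprod_bij _)) card_fprod.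
by apply: eq_bigr => k _; rewrite card_ord.
Qed.

Lemma card_tensors (F : finFieldType) (q n : nat) (s : 'I_n -> nat) :
  #|{: tensors F q s}| = #|F| ^ (q * \prod_(k < n) s k).
Proof. by rewrite !card_ffun card_ord card_tindex -expnM mulnC. Qed.

(** Orthogonality of characters: this is a geometric sum in [x = z ^+ j / z ^+ l], with
    [x ^+ d = 1], and [x = 1] only if [j = l] because both exponents are below [d]. *)
Lemma sum_prim_root (F : fieldType) (d : nat) (z : F) (j l : 'I_d) :
  (d.-primitive_root z ->
   \sum_(i < d) z ^+ (i * j) * z ^- (i * l) = if j == l then d%:R else 0)%R.
Proof.
move=> zP; have z0 : (z != 0)%R.
  by rewrite (prim_root_eq0 zP) -lt0n (prim_order_gt0 zP).
set x := (z ^+ j / z ^+ l)%R.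
under eq_bigr => i _ do rewrite mulnC (mulnC i) !exprM -exprVn -exprMn -/x.
have zl0 : (z ^+ l != 0)%R by rewrite expf_neq0.
have x1 : (x == 1)%R = (j == l).
  rewrite -(inj_eq (mulIf zl0)) divfK // mul1r (eq_prim_root_expr zP).
  by rewrite !modn_small.
case: (j == l) x1 => [/eqP x1|x1].
  under eq_bigr => i _ do rewrite x1 expr1n.
  by rewrite sumr_const card_ord.
have xd : (x ^+ d = 1)%R.
  by rewrite exprMn exprVn -!exprM !(mulnC _ d) !exprM (prim_expr_order zP)
     !expr1n invr1 mulr1.
have := subrX1 x d; rewrite xd subrr => /esym/eqP.
by rewrite mulf_eq0 subr_eq0 x1 => /eqP.
Qed.

(** After the sums are exchanged, the coefficient of [t h j] factors into one-dimensional
    orthogonality sums; if [j != l], a coordinate where they differ contributes a zero factor. *)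
Lemma dft_inversion (F : finFieldType) (q n : nat) (s : 'I_n -> nat)
    (omega : nat -> F) (t : tensors F q s) (h : 'I_q) (l : tindex s) :
  (forall k, (s k).-primitive_root (omega (s k)))%R ->
  (\sum_(i : tindex s)
     dft omega t h i * \prod_(k < n) omega (s k) ^- (i k * l k) =
   t h l * \prod_(k < n) (s k)%:R)%R.
Proof.
move=> omegaP.
under eq_bigr => i _ do rewrite !ffunE big_distrl.
rewrite exchange_big (bigD1 l) //= [X in (_ + X)%R]big1 ?addr0 => [|j jl].
  under eq_bigr => i _ do rewrite -mulrA -big_split /=.
  rewrite -mulr_sumr; congr (_ * _)%R.
  rewrite -(@bigA_distr_dffun _ _ (fun k : 'I_n => 'I_(s k))
    (fun k i => omega (s k) ^+ (i * l k) * omega (s k) ^- (i * l k))%R).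
  by apply: eq_bigr => k _; rewrite sum_prim_root ?eqxx.
under eq_bigr => i _ do rewrite -mulrA -big_split /=.
rewrite -mulr_sumr.
rewrite -(@bigA_distr_dffun _ _ (fun k : 'I_n => 'I_(s k))
    (fun k i => omega (s k) ^+ (i * j k) * omega (s k) ^- (i * l k))%R).
have /existsP[k jlk] : [exists k, j k != l k].
  apply: contraNT jl => /existsPn jl; apply/eqP/ffunP => k.
  by apply/eqP; have := jl k; rewrite negbK.
by rewrite (bigD1 k) //= sum_prim_root // (negPf jlk) mul0r mulr0.
Qed.

Lemma dft_inj (F : finFieldType) (q n : nat) (s : 'I_n -> nat)
    (omega : nat -> F) :
  (forall k, (s k).-primitive_root (omega (s k)))%R ->
  injective (@dft F q n s omega).
Proof.
move=> omegaP t t' tt'; apply/ffunP => h; apply/ffunP => l.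
(* A primitive [s k]-th root exists in [F] only if the characteristic does not divide [s k], so the
   factor in the inversion formula cancels. *)
have s0 : (\prod_(k < n) (s k)%:R != 0 :> F)%R.
  by apply/prodf_neq0 => k _; apply: prim_root_natf_neq0 (omegaP k).
by apply: (mulIf s0); rewrite -!(dft_inversion _ _ _ omegaP) tt'.
Qed.

Lemma recoverable_geq (F : finFieldType) (q n : nat) (s : 'I_n -> nat)
    (m N : nat) (omega : nat -> F) (st : strategy F q s m N) (k : nat) :
  injective (@dft F q n s omega) -> m %| q * \prod_(k < n) s k ->
  0 < q * \prod_(k < n) s k -> k <= N -> recoverable omega st k -> m <= k.
Proof.
move=> dftI m_dvd qs_gt0 kN rec.
(* Here [k <= N] is essential: without a set of size [k], recoverability would say nothing. *)
have [S Sk] : exists S : {set 'I_N}, #|S| = k.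
  exists [set widen_ord kN i | i : 'I_k].
  by rewrite card_imset ?card_ord // => i j [] /val_inj.
have [d dP] := rec S Sk.
have /leq_card : injective (fun t =>
    [ffun i : {i : 'I_N | i \in S} => worker_output st (val i) t]).
  by move=> t t' tt'; apply: dftI; rewrite -!dP tt'.
rewrite card_tensors card_ffun card_mx mul1n card_sig Sk.
rewrite -expnM leq_exp2l; last exact: card_finNzRing_gt1.
have w_gt0 : 0 < worker_size q s m.
  by rewrite /worker_size divn_gt0 ?(dvdn_gt0 qs_gt0 m_dvd) // dvdn_leq.
by rewrite -[X in X <= _](divnK m_dvd) leq_pmul2l.
Qed.

Definition rs_encode (F : fieldType) (m w : nat) (A : 'M[F]_(m, w)) (x : F) :
    'rV[F]_w :=
  (\row_c \sum_(j < m) A j c * x ^+ j)%R.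

(** Each column of [A - B] lists the coefficients of a polynomial of degree below [m] that vanishes
    on the at least [m] points of [X], hence is zero. *)
Lemma rs_encode_inj (F : finFieldType) (m w : nat) (X : {set F})
    (A B : 'M[F]_(m, w)) :
  m <= #|X| -> {in X, rs_encode A =1 rs_encode B} -> A = B.
Proof.
move=> mX AB; apply/matrixP => j c.
pose p : {poly F} := rVpoly (col c (A - B))^T%R.
suff p0 : p = 0%R.
  have := congr1 (fun r : {poly F} => r`_j)%R p0.
  rewrite coef_rVpoly_ord coef0 !mxE => /eqP.
  by rewrite subr_eq0 => /eqP.
apply: (@roots_geq_poly_eq0 _ _ (enum X)).
- apply/allP => x; rewrite mem_enum => xX; apply/eqP.
  have /rowP/(_ c) := AB x xX; rewrite !mxE => /eqP.
  rewrite -subr_eq0 -sumrB => /eqP <-.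
  rewrite (horner_coef_wide _ (size_poly _ _)).
  by apply: eq_bigr => i _; rewrite coef_rVpoly_ord !mxE mulrBl.
- exact: enum_uniq.
- by rewrite -cardE (leq_trans (size_poly _ _)).
Qed.

Lemma recoverable_inj (F : finFieldType) (q n : nat) (s : 'I_n -> nat)
    (m N : nat) (omega : nat -> F) (st : strategy F q s m N) (k : nat) :
  (forall (S : {set 'I_N}) t t', #|S| = k ->
     {in S, forall i, worker_output st i t = worker_output st i t'} ->
     t = t') ->
  recoverable omega st k.
Proof.
move=> stI S Sk.
pose b t := [ffun i : {i : 'I_N | i \in S} => worker_output st (val i) t].
(* The decoder searches for an input producing [y]; the zero default only covers values [y] that no
   input produces. *)
exists (fun y => dft omega (odflt [ffun=> [ffun=> 0%R]] [pick t | b t == y])).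
move=> t; rewrite -/(b t); case: pickP => [t' /eqP/ffunP bt|/(_ t)]; last first.
  by rewrite eqxx.
congr dft; apply: (stI S) => // i iS.
by have := bt (Sub i iS); rewrite !ffunE.
Qed.

Lemma exists_recoverable (F : finFieldType) (q n : nat) (s : 'I_n -> nat)
    (m N : nat) (omega : nat -> F) :
  m %| q * \prod_(k < n) s k -> N <= #|F| ->
  exists st : strategy F q s m N, recoverable omega st m.
Proof.
move=> m_dvd NF.
have cardE : #|{: tensors F q s}| <= #|{: 'M[F]_(m, worker_size q s m)}|.
  by rewrite card_tensors card_mx [X in _ <= _ ^ X]mulnC divnK.
(* Any injection serves as packing, so inputs and matrices are simply matched by their ranks in the
   enumerations. *)
pose pack (t : tensors F q s) : 'M[F]_(m, worker_size q s m) :=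
  enum_val (widen_ord cardE (enum_rank t)).
have packI : injective pack.
  by move=> t t' /enum_val_inj [] /val_inj /enum_rank_inj.
pose pt (i : 'I_N) : F := enum_val (widen_ord NF i).
have ptI : injective pt by move=> i j /enum_val_inj [] /val_inj.
exists (Strategy (fun i t => rs_encode (pack t) (pt i)) (fun _ => id)).
apply: recoverable_inj => S t t' Sm SP; apply: packI.
apply: (@rs_encode_inj _ _ _ (pt @: S)); first by rewrite card_imset // Sm.
by move=> _ /imsetP[i iS ->]; apply: SP.
Qed.

Theorem theorem6 (n q m N : nat) (s : 'I_n -> nat) (F : finFieldType)
    (omega : nat -> F)
    (n_gt0 : 0 < n) (q_gt0 : 0 < q) (m_gt0 : 0 < m) (N_gt0 : 0 < N)
    (s_gt0 : forall k : 'I_n, 0 < s k)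
    (m_le_N : m <= N)
    (m_dvd_qs : m %| q * \prod_(k < n) s k)
    (N_le_F : N <= #|F|)
    (omega_prim : forall k : 'I_n, ((s k).-primitive_root (omega (s k)))%R) :
  is_minimum
    (fun K : nat => exists st : strategy F q s m N,
       is_recovery_threshold omega st K)
    m.
Proof.
have dftI := dft_inj (q := q) omega_prim.
have qs_gt0 : 0 < q * \prod_(k < n) s k.
  by rewrite muln_gt0 q_gt0 prodn_gt0.
(* The lower bound is used twice: against every competing strategy, and to show that the threshold
   of the constructed one is exactly [m]. *)
split=> [|K [st [[KN rec] _]]]; last exact: recoverable_geq rec.
have [st rec] := exists_recoverable omega m_dvd_qs N_le_F.
by exists st; split=> // j [jN]; apply: recoverable_geq.
Qed.
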